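(* For every positive integer $t$ and every $r\ge 2$ there exist $\varepsilon=\varepsilon_{t,r}>0$ and $n_0=n_{t,r}$ such that the following holds. Suppose $G$ is a $K_r^+[t]$-free graph with $m$ edges, and $H$ is a complete $r$-partite graph with $V(H)\subseteq V(G)$, each partite set of $H$ having at least $n_0$ vertices, such that $G$ and $H$ (viewing $H$ as a graph on $V(G)$ by adding isolated vertices) differ in at most $\varepsilon m$ edges; moreover, when $r\ge 3$, all partite sets of $H$ have equal size. Then $$\lambda^2(G)\le\left(1-\frac1r\right)2m,$$ with equality if and only if $G$ is a complete bipartite graph when $r=2$, or $G$ is the regular complete $r$-partite graph (all parts equal in size) when $r\ge 3$.
   Context: All graphs are finite and simple; isolated vertices are ignored. $K_r[t]$ is the complete $r$-partite graph with all parts of size $t$, and $K_r^+[t]$ is obtained from $K_r[t]$ by adding one edge inside one of its parts. $F$-free means no subgraph isomorphic to $F$. ''Differ in at most $\varepsilon m$ edges'' means the edit distance (minimum number of edge additions/deletions to transform one graph into the other) is at most $\varepsilon m$. $\lambda(G)$ is the spectral radius of the adjacency matrix.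
   Formalization: For t = 1 the graph K_r^+[1] is undefined (no edge fits inside a one-vertex part); the formal statement takes K_r^+[1] to be K_{r+1}. All t ≥ 2 are as stated. *)

(* Defs.v *)
From HB Require Import structures.
From mathcomp Require Import all_boot all_order all_algebra all_field.
Set Implicit Arguments. Unset Strict Implicit. Unset Printing Implicit Defensive.
Import Order.TTheory GRing.Theory Num.Theory.
Local Open Scope ring_scope.

(* A simple graph on a finite vertex type V is a symmetric irreflexive
   relation G : rel V.  Isolated vertices are ignored throughout. *)
Definition simple_graph (V : finType) (G : rel V) : Prop :=
  symmetric G /\ irreflexive G.

Definition num_edges (V : finType) (G : rel V) : nat :=
  (#|[set p : V * V | G p.1 p.2]| %/ 2)%N.

Definition edit_dist (V : finType) (G H : rel V) : nat :=
  (#|[set p : V * V | G p.1 p.2 != H p.1 p.2]| %/ 2)%N.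

(* K_r[t] together with an extra edge inside one part, embedded as a
   (not necessarily induced) subgraph via an injective vertex map f.
   For t = 1 no edge can be added inside a part; we use the convention
   K_r^+[1] := K_{r+1}. *)
Definition contains_Krplus (V : finType) (G : rel V) (r t : nat) : Prop :=
  if t == 1%N then
    exists f : 'I_r.+1 -> V, injective f /\
      forall i j, i != j -> G (f i) (f j)
  else
    exists f : 'I_r * 'I_t -> V, injective f /\
      (forall p q : 'I_r * 'I_t, p.1 != q.1 -> G (f p) (f q)) /\
      exists i : 'I_r, exists a b : 'I_t, a != b /\ G (f (i, a)) (f (i, b)).

Definition complete_multipartite_on (V : finType) (r : nat)
    (P : 'I_r -> {set V}) (H : rel V) : Prop :=
  (forall i j, i != j -> [disjoint P i & P j]) /\
  forall x y, H x y = [exists i, exists j, [&& i != j, x \in P i & y \in P j]].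

(* G is a complete r-partite graph (isolated vertices ignored): nonempty parts *)
Definition is_complete_multipartite (V : finType) (r : nat) (G : rel V) : Prop :=
  exists P : 'I_r -> {set V},
    (forall i, P i != set0) /\ complete_multipartite_on P G.

Definition is_regular_complete_multipartite (V : finType) (r : nat) (G : rel V)
  : Prop :=
  exists P : 'I_r -> {set V},
    (forall i, P i != set0) /\ (forall i j, #|P i| = #|P j|) /\
    complete_multipartite_on P G.

Definition adj_mx (V : finType) (G : rel V) : 'M[algC]_#|V| :=
  \matrix_(i, j) ((G (enum_val i) (enum_val j))%:R : algC).

Definition is_spectral_radius (n : nat) (A : 'M[algC]_n) (l : algC) : Prop :=
  (exists a, eigenvalue A a /\ `|a| = l) /\
  (forall a, eigenvalue A a -> `|a| <= l).

(* Main.v *)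
Require Import Defs.
From HB Require Import structures.
From mathcomp Require Import all_boot all_order all_algebra all_field.
From mathcomp Require Import ring lra.
Import Order.TTheory GRing.Theory Num.Theory.
Local Open Scope ring_scope.

Set Implicit Arguments.
Unset Strict Implicit.
Unset Printing Implicit Defensive.

(** Let [x] be the entrywise absolute value of a unit eigenvector for the
    spectral radius [lam], let [y = x^2], a probability weight on the vertices,
    and let [M = 2m]. Cauchy-Schwarz gives [lam^2 <= M * W], where [W] is the sum
    of [y u * y v] over ordered edges, so it is enough to show [W <= 1 - 1/r]
    when [lam^2 >= (1 - 1/r) M]. In that case every [y u] is small, because
    [lam^2 * y u <= deg u]; applying Cauchy-Schwarz to [G] inside [H] shows that
    the parts of [H] have weight close to [1/r] and that few edges of [H], by
    weight, are missing from [G]. Hence [r]-partite copies can be chosen greedily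
    in any sets of non-negligible weight. Since [G] has no [K_r^+[t]], each vertex
    has negligible weight of neighbours in some part; vertices of almost full
    weighted degree with the same such part are not adjacent, so they induce an
    [r]-partite graph. The remaining vertices have too small a degree to
    compensate for their own weight, so their total weight is [0] and
    [W <= 1 - 1/r]. In the case of equality the graph is complete [r]-partite
    with parts of equal weight, and [x u * x v] is constant along the edges. *)

(** * Variance identities and Cauchy-Schwarz *)

Section SumOfSquares.

Variables (R : realFieldType) (T : finType) (E : pred T) (F : T -> R).

Lemma sum_sqr_shift (k : R) :
  \sum_(i | E i) (F i - k) ^+ 2
    = \sum_(i | E i) F i ^+ 2 - 2 * k * (\sum_(i | E i) F i) + #|E|%:R * k ^+ 2.
Proof.
have <- : \sum_(i | E i) k ^+ 2 = #|E|%:R * k ^+ 2.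
  by rewrite mulr_natl; exact: sumr_const.
rewrite mulr_sumr -sumrB -big_split /=.
by apply: eq_bigr => i _; ring.
Qed.

(* For [#|E| = 0] both sides vanish, thanks to [x / 0 = 0]. *)
Lemma sum_sqr_dev (s := \sum_(i | E i) F i) :
  \sum_(i | E i) F i ^+ 2
    = s ^+ 2 / #|E|%:R + \sum_(i | E i) (F i - s / #|E|%:R) ^+ 2.
Proof.
rewrite sum_sqr_shift -/s; have [E0|E0] := eqVneq (#|E|%:R : R) 0; last by field.
have E_empty : E =1 pred0 by apply/card0_eq/eqP; rewrite -(pnatr_eq0 R) E0.
by rewrite E0 invr0 !(big_pred0 _ _ _ _ E_empty); ring.
Qed.

(** Cauchy-Schwarz against the constant 1; the defect is the sum of squared deviations in
    [sum_sqr_dev], which later settles the equality case. *)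
Lemma sqr_sum_le_card :
  (\sum_(i | E i) F i) ^+ 2 <= #|E|%:R * (\sum_(i | E i) F i ^+ 2).
Proof.
have [E0|E0] := eqVneq (#|E|%:R : R) 0.
  have E_empty : E =1 pred0 by apply/card0_eq/eqP; rewrite -(pnatr_eq0 R) E0.
  by rewrite E0 mul0r !(big_pred0 _ _ _ _ E_empty) expr2 mul0r.
rewrite sum_sqr_dev mulrDr mulrC divfK // lerDl mulr_ge0 ?ler0n //.
by apply: sumr_ge0 => i _; exact: sqr_ge0.
Qed.

End SumOfSquares.

(** * Weighted degrees and greedy transversals *)

Section Weights.

Variables (R : realFieldType) (V : finType) (y : V -> R).
Hypothesis y_ge0 : forall u, 0 <= y u.

Definition wt (A : {set V}) : R := \sum_(u in A) y u.
Definition wdeg (E : rel V) (u : V) : R := \sum_(v | E u v) y v.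
(** Ordered pairs are summed, so an edge of a symmetric relation counts twice; a complete
    [r]-partite graph with parts of weight [1/r] gives [1 - 1/r]. *)
Definition ewt (E : rel V) : R := \sum_u y u * wdeg E u.

Lemma ewtE (E : rel V) :
  ewt E = \sum_u \sum_v (E u v)%:R * (y u * y v).
Proof.
apply: eq_bigr => u _; rewrite mulr_sumr big_mkcond /=.
by apply: eq_bigr => v _; case: (E u v); rewrite ?mul1r ?mul0r.
Qed.

Lemma sum_ge0_sub (P Q : pred V) (F : V -> R) :
  (forall u, 0 <= F u) -> subpred P Q ->
  \sum_(u | P u) F u <= \sum_(u | Q u) F u.
Proof.
move=> F0 PQ; rewrite [leRHS](bigID P) /= -[leLHS]addr0.
rewrite (eq_bigl P) => [|u]; last by apply: andb_idl; exact: PQ.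
by rewrite lerD2l sumr_ge0.
Qed.

Lemma wt_ge0 A : 0 <= wt A. Proof. exact: sumr_ge0. Qed.

Lemma wdeg_ge0 E u : 0 <= wdeg E u. Proof. exact: sumr_ge0. Qed.

Lemma wt_subset (A B : {set V}) : A \subset B -> wt A <= wt B.
Proof. by move/subsetP=> AB; apply: sum_ge0_sub. Qed.

Lemma wtID (A B : {set V}) : wt A = wt (A :&: B) + wt (A :\: B).
Proof.
by rewrite /wt (big_setID B).
Qed.

Lemma wtI_ge (A B C : {set V}) :
  B \subset A -> C \subset A -> wt B + wt C - wt A <= wt (B :&: C).
Proof.
move=> BA CA; rewrite (wtID B C).
suff: wt (B :\: C) + wt C <= wt A by lra.
rewrite (wtID A C) (setIidPr CA) addrC lerD2l.
by apply/wt_subset/setSD.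
Qed.

(** Averaging: if every vertex of [A] had degree above [d], then [A] alone would contribute at least
    [g * d] to [ewt B]. *)
Lemma low_wdeg_vertex (B : rel V) (A : {set V}) (g d : R) :
  0 <= d -> g <= wt A -> ewt B < g * d -> exists2 v, v \in A & wdeg B v <= d.
Proof.
move=> d0 gA Bd; apply/exists_inP; apply: contraLR Bd.
rewrite negb_exists_in -leNgt => /forall_inP /= Ad.
apply: (@le_trans _ _ (\sum_(u in A) y u * wdeg B u)).
  apply: (@le_trans _ _ (wt A * d)); first exact: ler_wpM2r.
  rewrite mulr_suml; apply: ler_sum => u /Ad; rewrite -ltNge => /ltW.
  exact: ler_wpM2l.
by apply: sum_ge0_sub => // u; rewrite mulr_ge0 ?wdeg_ge0.
Qed.

(* Greedy choice: a vertex of small bad degree is picked from the first set and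
   its bad neighbours are removed from the others, which costs each at most [d]. *)
Lemma weighted_transversal (K : eqType) (s : seq K) (B : rel V) (S : K -> {set V})
    (g d : R) (v0 : V) :
  symmetric B -> 0 <= d -> ewt B < g * d -> uniq s ->
  (forall k, k \in s -> g + (size s)%:R * d <= wt (S k)) ->
  exists f : K -> V, (forall k, k \in s -> f k \in S k) /\
    (forall k l, k \in s -> l \in s -> k != l -> ~~ B (f k) (f l)).
Proof.
move=> symB d0 Bd; elim: s S => [|k s IH] S /=; first by exists (fun=> v0).
move=> /andP[kNs us] gS.
have [|v vS vd] := @low_wdeg_vertex B (S k) g d d0 _ Bd.
  by have := gS k (mem_head _ _); have := mulr_ge0 (ler0n R (size s).+1) d0; lra.
have [//|l ls|f [fS fB]] := IH (fun l => S l :\: [set u | B v u]).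
  have := gS l; rewrite inE ls orbT => /(_ isT).
  rewrite (wtID (S l) [set u | B v u]) -natr1 mulrDl mul1r.
  suff: wt (S l :&: [set u | B v u]) <= wdeg B v by lra.
  by apply: sum_ge0_sub => // u; rewrite !inE => /andP[].
exists (fun l => if l == k then v else f l); split=> [l|l l'].
  rewrite inE; case: eqP => [-> //|_] /= /fS.
  by rewrite inE => /andP[].
rewrite !inE; case: (altP (l =P k)) => [->|lk] /=.
  case: (altP (l' =P k)) => [-> //|_] /=; first by rewrite eqxx.
  by move=> _ /fS; rewrite !inE => /andP[].
move=> ls; case: (altP (l' =P k)) => [_ _ _|l'k /= l's]; last exact: fB.
by rewrite symB; move: (fS _ ls); rewrite !inE => /andP[].
Qed.

End Weights.

(** * Completing a partite copy by an inner edge *)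

(** The images of [(i, a)] and [(i, b)] are replaced by [u] and [v]. Nothing is asked of [f] at
    these two places, so [u] or [v] may already be one of their images. *)
Lemma contains_Krplus_of_copy (V : finType) (G : rel V) (r t : nat)
    (f : 'I_r * 'I_t -> V) (i : 'I_r) (a b : 'I_t) (u v : V) :
  symmetric G -> irreflexive G -> a != b -> G u v ->
  (forall p, p != (i, a) -> p != (i, b) -> (f p != u) && (f p != v)) ->
  (forall p, p.1 != i -> G u (f p) && G v (f p)) ->
  injective f -> (forall p q, p.1 != q.1 -> G (f p) (f q)) ->
  contains_Krplus G r t.
Proof.
move=> symG irrG ab Guv fuv Guvf injf Gf; rewrite /contains_Krplus.
case: eqP => [t1|_].
  by move: a b ab {fuv f Guvf injf Gf}; rewrite t1 => a b; rewrite !ord1 eqxx.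
have uv : u != v by apply: contraTneq Guv => ->; rewrite irrG.
have iab : (i, b) != (i, a) by rewrite xpair_eqE eqxx eq_sym.
pose g p := if p == (i, a) then u else if p == (i, b) then v else f p.
exists g; split; last split.
- move=> p q; rewrite /g.
  case: (eqVneq p (i, a)) => [->|pa]; case: (eqVneq q (i, a)) => [->|qa] //.
  + case: (eqVneq q (i, b)) => [_ /eqP|qb /eqP]; first by rewrite (negPf uv).
    by have /andP[/negPf] := fuv q qa qb; rewrite eq_sym => ->.
  + case: (eqVneq p (i, b)) => [_ /eqP|pb /eqP].
      by rewrite eq_sym (negPf uv).
    by have /andP[/negPf ->] := fuv p pa pb.
  case: (eqVneq p (i, b)) => [->|pb]; case: (eqVneq q (i, b)) => [->|qb] //.
  + by move/eqP; have /andP[_ /negPf] := fuv q qa qb; rewrite eq_sym => ->.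
  + by move/eqP; have /andP[_ /negPf ->] := fuv p pa pb.
  exact: injf.
- have gN p : p.1 != i -> g p = f p.
    by case: p => k c /= ki; rewrite /g !xpair_eqE (negPf ki).
  have gG p q : q.1 != i -> p.1 != q.1 -> G (g p) (g q).
    move=> qi pq; rewrite (gN q qi) /g.
    have /andP[uq vq] := Guvf q qi.
    by case: ifP => // _; case: ifP => // _; exact: Gf.
  move=> p q pq; case: (eqVneq q.1 i) => [qi|]; last by move/gG; exact.
  by rewrite symG; apply: gG; rewrite -?qi // eq_sym.
- by exists i, a, b; rewrite /g !eqxx (negPf iab).
Qed.

(** * Basic facts on complete multipartite graphs *)

Section Multipartite.

Variables (V : finType) (r : nat) (P : 'I_r -> {set V}) (H : rel V).
Hypothesis HP : complete_multipartite_on P H.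

Lemma multipartite_edge i j u v : i != j -> u \in P i -> v \in P j -> H u v.
Proof.
move=> ij ui vj; rewrite HP.2.
by apply/existsP; exists i; apply/existsP; exists j; rewrite ij ui.
Qed.

Lemma multipartite_part_unique i j u : u \in P i -> u \in P j -> i = j.
Proof.
move=> ui uj; apply/eqP/negPn/negP => ij.
by have := disjointFr (HP.1 i j ij) ui; rewrite uj.
Qed.

Lemma multipartite_sym : symmetric H.
Proof.
suff HS u v : H u v -> H v u by move=> u v; apply/idP/idP; exact: HS.
rewrite HP.2 => /existsP[i /existsP[j /and3P[ij ui vj]]].
by apply: (multipartite_edge _ vj ui); rewrite eq_sym.
Qed.

Lemma multipartite_irr : irreflexive H.
Proof.
move=> u; rewrite HP.2; apply/negbTE/negP.
move=> /existsP[i /existsP[j /and3P[/eqP ij ui uj]]].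
exact/ij/(multipartite_part_unique ui uj).
Qed.

Lemma multipartite_nbhd i u : u \in P i ->
  H u =1 [pred v | v \in (\bigcup_j P j) :\: P i].
Proof.
move=> ui v /=; rewrite inE; apply/idP/andP => [|[vNi /bigcupP[j _ vj]]].
  rewrite HP.2 => /existsP[i' /existsP[j /and3P[ij ui' vj]]].
  rewrite -(multipartite_part_unique ui ui') in ij.
  split; last by apply/bigcupP; exists j.
  by apply: contraNN ij => vi; rewrite (multipartite_part_unique vi vj).
by apply: (multipartite_edge _ ui vj); apply: contraNneq vNi => ->.
Qed.

Lemma wt_cover (R : realFieldType) (y : V -> R) :
  wt y (\bigcup_j P j) = \sum_j wt y (P j).
Proof.
by rewrite /wt partition_disjoint_bigcup //= => i j ij; exact: HP.1.
Qed.

End Multipartite.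

(** * Stability for vertex-weighted graphs *)

Section WeightedStability.

Variables (R : realFieldType) (V : finType) (y : V -> R).
Hypothesis y_ge0 : forall u, 0 <= y u.
Hypothesis y_sum1 : \sum_u y u = 1.

Variables (r t : nat) (G H : rel V) (P : 'I_r -> {set V}).
Hypothesis t_gt1 : (1 < t)%N.
Hypothesis r_gt1 : (1 < r)%N.
Hypothesis simpleG : simple_graph G.
Hypothesis HP : complete_multipartite_on P H.
Hypothesis Gfree : ~ contains_Krplus G r t.

Let rho : R := r%:R^-1.
(** Threshold for negligible weight: a part of weight about [rho] can lose several multiples of [c]
    and still host a partite copy. *)
Let c : R := rho / 16.

(** A single error parameter bounds the vertex weights, the imbalance of the parts and the weight of
    the edges of [H] missing from [G]. *)
Variable b : R.
Hypothesis y_le : forall u, y u <= b.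
Hypothesis b_lt : 2 * b < c / 2 * (c / (2 * (r * t)%:R)).
Hypothesis rb_le : r%:R * b <= rho / 1000.
Hypothesis Pb : forall i, `|wt y (P i) - rho| <= b.
Hypothesis HGb : ewt y (fun u v => H u v && ~~ G u v) <= b.

Let symG : symmetric G := simpleG.1.
Let irrG : irreflexive G := simpleG.2.
Let nb u := [set v | G u v].
(** Equality counts as bad, so that a transversal avoiding bad pairs is automatically injective. *)
Let bad u v := (u == v) || (H u v && ~~ G u v).

Let rho_gt0 : 0 < rho. Proof. by rewrite invr_gt0 ltr0n (leq_trans _ r_gt1). Qed.
Let r_gt0 : 0 < r%:R :> R. Proof. by rewrite ltr0n (leq_trans _ r_gt1). Qed.
Let rrho : r%:R * rho = 1. Proof. by rewrite divff ?gt_eqF. Qed.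
Let V0 : V.
Proof.
case: (pickP (fun _ : V => true)) => [v _ //|V0]; exfalso.
by have := oner_neq0 R; rewrite -y_sum1 big_pred0 ?eqxx // => u; have := V0 u.
Qed.

Let b_ge0 : 0 <= b. Proof. exact: le_trans (y_ge0 V0) (y_le V0). Qed.

Let b_le : b <= rho / 1000.
Proof.
have: 1 <= r%:R :> R by rewrite (ler_nat R 1) ltnW.
by move: b_ge0 rb_le; nra.
Qed.

Let P_le i : wt y (P i) <= rho + b.
Proof. by have := Pb i; rewrite ler_norml => /andP[]; lra. Qed.
Let P_ge i : rho - b <= wt y (P i).
Proof. by have := Pb i; rewrite ler_norml => /andP[]; lra. Qed.

(** The diagonal adds at most [y u <= b] to each weighted degree, and the degrees are averaged with
    total weight 1. *)
Lemma ewt_bad : ewt y bad <= 2 * b.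
Proof.
rewrite mulr_natl mulr2n; apply: le_trans (lerD (lexx b) HGb).
have -> : b = \sum_u y u * b by rewrite -mulr_suml y_sum1 mul1r.
rewrite /ewt -big_split /=; apply: ler_sum => u _; rewrite -mulrDr.
apply: ler_wpM2l => //.
apply: (@le_trans _ _ (y u + wdeg y (fun u v => H u v && ~~ G u v) u)).
  rewrite /wdeg [leLHS](bigD1 u) /=; last by rewrite /bad eqxx.
  rewrite lerD2l.
  by apply: sum_ge0_sub => // v; rewrite /= /bad eq_sym andb_orl andbN => /andP[].
by rewrite lerD2r.
Qed.

(** A greedy transversal over the [r * t] indices, each [S i] being used [t] times. Half of [c] is
    kept in reserve and the other half is shared among the removals. *)
Lemma partite_copy (S : 'I_r -> {set V}) :
  (forall i, S i \subset P i) -> (forall i, c <= wt y (S i)) ->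
  exists f : 'I_r * 'I_t -> V, [/\ forall p, f p \in S p.1, injective f &
    forall p q, p.1 != q.1 -> G (f p) (f q)].
Proof.
move=> SP Sc.
have rt0 : 0 < (r * t)%:R :> R by rewrite ltr0n muln_gt0 (ltnW r_gt1) (ltnW t_gt1).
have symbad : symmetric bad.
  by move=> u v; rewrite /bad eq_sym (multipartite_sym HP) symG.
have := @weighted_transversal _ _ y y_ge0 _ (enum {: 'I_r * 'I_t}) bad
  (fun p => S p.1) (c / 2) (c / (2 * (r * t)%:R)) V0 symbad.
case => [|||p _|f [fS fB]].
- by rewrite divr_ge0 ?mulr_ge0 ?ltW // /c; lra.
- exact: le_lt_trans ewt_bad b_lt.
- exact: enum_uniq.
- rewrite -cardE card_prod !card_ord; apply: le_trans (Sc p.1).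
  rewrite le_eqVlt; apply/orP; left; apply/eqP; field.
  by rewrite !pnatr_eq0 -!lt0n (ltnW r_gt1) (ltnW t_gt1).
have fPi p : f p \in S p.1 by apply: fS; rewrite mem_enum.
have fN p q : p != q -> ~~ bad (f p) (f q) by apply: fB; rewrite mem_enum.
exists f; split=> // [p q fpq|p q pq].
  by apply/eqP/negPn/negP => /fN; rewrite /bad fpq eqxx.
have /fN : p != q by apply: contraNneq pq => ->.
rewrite negb_or negb_and negbK => /andP[_ /orP[|//]].
by rewrite (multipartite_edge HP pq) //; apply: (subsetP (SP _)).
Qed.

Let a0 : 'I_t := Ordinal (ltnW t_gt1).
Let a1 : 'I_t := Ordinal t_gt1.
Let a01 : a0 != a1. Proof. by []. Qed.

(** Otherwise a partite copy lies inside the neighbourhood of [u]; putting [u] in place of one of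
    its vertices creates an edge inside a part. *)
Lemma small_part_exists u : exists i, wt y (P i :&: nb u) < c.
Proof.
apply/existsP; apply: contra_notT Gfree; rewrite negb_exists => /forallP Nc.
have [||f [fS fI fG]] := @partite_copy (fun i => P i :&: nb u).
- by move=> i; exact: subsetIl.
- by move=> i; rewrite leNgt.
have Guf p : G u (f p) by move: (fS p); rewrite !inE => /andP[].
pose i0 : 'I_r := Ordinal (ltnW r_gt1).
apply: (@contains_Krplus_of_copy _ _ _ _ f i0 a0 a1 u (f (i0, a1))) => //.
  move=> p _ pa1; rewrite (inj_eq fI) pa1 andbT.
  by apply: contraTneq (Guf p) => ->; rewrite irrG.
by move=> p pi0; rewrite Guf fG //= eq_sym.
Qed.

(** The weighted degree in the balanced complete [r]-partite graph is [1 - rho]; [c] is the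
    tolerated loss. *)
Definition lowdeg := [set u | wdeg y G u < 1 - rho - c].

(** Missing almost all of [P i] already costs about [rho], so the degree condition leaves a loss of
    at most about [2 * c] elsewhere. *)
Lemma other_parts_full u i j : u \notin lowdeg -> i != j ->
  wt y (P i :&: nb u) < c -> rho - 2 * c - 2 * b <= wt y (P j :&: nb u).
Proof.
rewrite inE -leNgt => uL ij Ni.
have Hd : wdeg y G u <= wt y (P i :&: nb u) + (wt y (P j :&: nb u)
    + wt y (~: (P i :|: P j))).
  have -> : wdeg y G u = wt y (nb u) by apply: eq_bigl => v; rewrite inE.
  rewrite (wtID y (nb u) (P i)) setIC lerD2l (wtID y _ (P j)) lerD //.
    by apply: wt_subset => //; apply/subsetP => v; rewrite !inE => /andP[/andP[_ ->] ->].
  by apply: wt_subset => //; apply/subsetP => v; rewrite !inE negb_or => /and3P[-> ->].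
have wC : wt y (~: (P i :|: P j)) = 1 - wt y (P i) - wt y (P j).
  have -> : 1 = wt y setT by rewrite -y_sum1; apply: eq_bigl => v; rewrite inE.
  rewrite (wtID y setT (P i)) (wtID y (setT :\: P i) (P j)) setTI setTD.
  have -> : ~: P i :&: P j = P j.
    by apply/setIidPr; rewrite -disjoints_subset; apply: HP.1; rewrite eq_sym.
  by rewrite setDE -setCU; lra.
by have := P_ge i; have := P_ge j; lra.
Qed.

(** If adjacent, [u] and [v] would serve as the extra edge in part [i]: their common neighbourhood
    in any other part weighs at least [rho - 4 * c - 5 * b], enough for a partite copy. *)
Lemma same_part_nonadjacent u v i : u \notin lowdeg -> v \notin lowdeg ->
  wt y (P i :&: nb u) < c -> wt y (P i :&: nb v) < c -> ~~ G u v.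
Proof.
move=> uL vL uc vc; apply/negP => Guv; apply: Gfree.
pose S j := if j == i then P i :\: [set u; v] else P j :&: nb u :&: (P j :&: nb v).
have SP j : S j \subset P j.
  rewrite /S; case: eqP => [->|_]; first exact: subsetDl.
  by rewrite -setIA subsetIl.
have Sc j : c <= wt y (S j).
  rewrite /S; case: (eqVneq j i) => [_|ji].
    have : wt y (P i :&: [set u; v]) <= y u + y v.
      apply: (le_trans (wt_subset y_ge0 (subsetIr _ _))).
      rewrite /wt big_setU1 ?big_set1 // inE.
      by apply: contraTneq Guv => ->; rewrite irrG.
    have := P_ge i; rewrite (wtID y (P i) [set u; v]).
    by have := y_le u; have := y_le v; have := b_le; have := rho_gt0; rewrite /c; lra.
  apply: le_trans (wtI_ge y_ge0 (subsetIl (P j) (nb u)) (subsetIl (P j) (nb v))).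
  have := other_parts_full uL _ uc; have := other_parts_full vL _ vc.
  move=> /(_ j); rewrite eq_sym => /(_ ji) + /(_ j).
  rewrite eq_sym => + /(_ ji); have := P_le j.
  by have := b_le; have := rho_gt0; rewrite /c; lra.
have [f [fS fI fG]] := partite_copy SP Sc.
have SN p : p.1 != i -> G u (f p) && G v (f p).
  move=> pi; have := fS p; rewrite /S (negPf pi) !inE.
  by case/andP => /andP[_ ->] /andP[_ ->].
apply: (@contains_Krplus_of_copy _ _ _ _ f i a0 a1 u v) => // p _ _.
case: (eqVneq p.1 i) => [pi|/SN/andP[Gu Gv]].
  by have := fS p; rewrite /S pi eqxx !inE negb_or => /andP[].
apply/andP; split; first by apply: contraTneq Gu => ->; rewrite irrG.
by apply: contraTneq Gv => ->; rewrite irrG.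
Qed.

(** Outside the parts there is weight at most [r * b]. Inside, a vertex of low degree misses at
    least [c / 2] of its [H]-neighbourhood, while all missing edges together weigh at most [b]. *)
Lemma wt_lowdeg : wt y lowdeg < 2 * c.
Proof.
set U := \bigcup_j P j.
have wtU : 1 - r%:R * b <= wt y U.
  rewrite (wt_cover HP); apply: (@le_trans _ _ (\sum_(j < r) (rho - b))).
    by rewrite sumr_const card_ord -[leRHS]mulr_natl mulrBr rrho.
  by apply: ler_sum.
have LNU : wt y (lowdeg :\: U) <= r%:R * b.
  have : wt y (lowdeg :\: U) <= wt y (~: U).
    by apply: wt_subset => //; rewrite setDE subsetIr.
  have : wt y U + wt y (~: U) = 1.
    have := wtID y setT U; rewrite setTI setTD -y_sum1 => <-.
    by apply: eq_bigl => u; rewrite inE.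
  by lra.
have LU : wt y (lowdeg :&: U) * (c / 2) <= b.
  apply: le_trans HGb; rewrite mulr_suml.
  apply: (@le_trans _ _ (\sum_(u in lowdeg :&: U) y u
      * wdeg y (fun u v => H u v && ~~ G u v) u)); last first.
    by apply: sum_ge0_sub => // u; rewrite mulr_ge0 ?wdeg_ge0.
  apply: ler_sum => u; rewrite 2!inE => /andP[uL /bigcupP[i _ ui]].
  apply: ler_wpM2l => //.
  have : wdeg y H u <= wdeg y G u + wdeg y (fun u v => H u v && ~~ G u v) u.
    rewrite /wdeg [leLHS](bigID (G u)) /= lerD2r.
    by apply: sum_ge0_sub => // v /andP[].
  have -> : wdeg y H u = wt y (U :\: P i).
    by apply: eq_bigl => v; rewrite (multipartite_nbhd HP ui).
  have : wt y U = wt y (P i) + wt y (U :\: P i).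
    by rewrite {1}(wtID y U (P i)) (setIidPr _) // bigcup_sup.
  by have := P_le i; have := b_le; have := rho_gt0; move: rb_le uL wtU; rewrite /c; lra.
rewrite (wtID y _ U).
have : b * r%:R <= rho / 1000 by rewrite mulrC.
have := wt_ge0 y_ge0 (lowdeg :&: U).
have := rho_gt0; have := rrho; move: LU LNU rb_le; rewrite /c.
set q := wt y _; set q' := wt y _; move=> LU LNU rb0 rr rh0 q0 _.
(* This is [r * b <= rho / 1000] times [rho]; it gives [q <= 32 * rho / 1000], well below
   [2 * c = rho / 8]. *)
have : b <= rho * rho / 1000 by nra.
by nra.
Qed.

(* With [q] the weight of [lowdeg], [D] the missing cross edges and [var] the
   variance of the class weights, the count of edges gives
   [D + var + q * (2 * c - (1 - rho) * q) <= 0], where all terms are nonnegative. *)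
Lemma weighted_stability : 1 - rho <= ewt y G ->
  exists cls : V -> 'I_r,
    [/\ forall u v, 0 < y u -> 0 < y v -> G u v = (cls u != cls v),
        forall i, wt y [set u | cls u == i] = rho & ewt y G = 1 - rho].
Proof.
move=> GW; pose cls u := xchoose (small_part_exists u).
have clsP u : wt y (P (cls u) :&: nb u) < c.
  exact: (xchooseP (small_part_exists u)).
exists cls; set L := lowdeg; pose q := wt y L.
pose C i := [set u | cls u == i] :\: L.
have Cdisj u v : u \notin L -> v \notin L -> G u v -> cls u != cls v.
  move=> uL vL; apply: contraTneq => uv; apply: same_part_nonadjacent uL vL _ _.
    exact: clsP.
  by rewrite uv.
have wtNL : \sum_(u | u \notin L) y u = 1 - q.
  by rewrite -y_sum1 (bigID (mem L) xpredT) /= addrC addrK.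
have wtC i : wt y (C i) = \sum_(u | (u \notin L) && (cls u == i)) y u.
  by apply: eq_bigl => u; rewrite !inE.
have sumC : \sum_i wt y (C i) = 1 - q.
  rewrite -wtNL (partition_big cls xpredT) //=.
  by apply: eq_bigr => i _; rewrite wtC.
pose D u v := [&& u \notin L, v \notin L, cls u != cls v & ~~ G u v].
pose E3 u v := [&& u \notin L, v \notin L & cls u != cls v].
pose E1 u v := (u \in L) && G u v.
have ewtE1 : ewt y E1 <= q * (1 - rho - c).
  rewrite mulr_suml big_mkcond /=; apply: ler_sum => u _; rewrite /wdeg /E1.
  case: ifP => [uL|_]; last by rewrite big_pred0_eq mulr0.
  by apply: ler_wpM2l => //; move: uL; rewrite /L inE => /ltW.
have ewtE2 : ewt y (fun u v => E1 v u) = ewt y E1.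
  rewrite !ewtE exchange_big /=; apply: eq_bigr => u _; apply: eq_bigr => v _.
  by rewrite [y u * y v]mulrC.
have ewtE3 : ewt y E3 = (1 - q) ^+ 2 - \sum_i wt y (C i) ^+ 2.
  transitivity (\sum_(u | u \notin L) (y u * (1 - q) - y u * wt y (C (cls u)))).
    rewrite /ewt [RHS]big_mkcond /=; apply: eq_bigr => u _; rewrite /wdeg /E3.
    case: (u \in L); first by rewrite big_pred0_eq mulr0.
    rewrite -mulrBr; congr (_ * _).
    rewrite -wtNL [in RHS](bigID (fun v => cls v == cls u)) /=.
    rewrite wtC [X in X - _]addrC addrK.
    by apply: eq_bigl => v; rewrite eq_sym.
  rewrite sumrB -mulr_suml wtNL -expr2; congr (_ - _).
  rewrite (partition_big cls xpredT) //=; apply: eq_bigr => i _.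
  rewrite expr2 {1}wtC mulr_suml; apply: eq_bigr => u /andP[_ /eqP -> //].
(* Pair by pair: an edge meeting [L] is counted by [E1] or its transpose; any other edge joins two
   classes, and [D] holds the pairs of [E3] that are not edges. *)
have main : ewt y G + ewt y D <= ewt y E1 + ewt y (fun u v => E1 v u) + ewt y E3.
  rewrite !ewtE -!big_split /=; apply: ler_sum => u _.
  rewrite -!big_split /=; apply: ler_sum => v _.
  rewrite -!mulrDl -!natrD; apply: ler_wpM2r; first exact: mulr_ge0.
  rewrite ler_nat /D /E1 /E3 (symG v u).
  have := Cdisj u v.
  case: (u \in L); case: (v \in L); case: (G u v); case: (cls u != cls v) => //=.
  by move=> /(_ isT isT isT).
have := sum_sqr_dev xpredT (fun i => wt y (C i)); rewrite /= sumC card_ord -/rho.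
set var := \sum_i (_ - _) ^+ 2 => sqC.
have var0 : 0 <= var by apply: sumr_ge0 => i _; exact: sqr_ge0.
have D0 : 0 <= ewt y D by apply: sumr_ge0 => u _; rewrite mulr_ge0 ?wdeg_ge0.
have q0 : 0 <= q := wt_ge0 y_ge0 L.
have q2 : q < 2 * c := wt_lowdeg.
have key : ewt y D + var + q * (2 * c - (1 - rho) * q) <= 0.
  by move: main; rewrite ewtE2 ewtE3 sqC; move: ewtE1 GW; lra.
have qq : (1 - rho) * q <= q by have := rho_gt0; nra.
(* Since [q < 2 * c], the second factor is positive, so the product can only vanish through [q]. *)
have q00 : q = 0.
  have : 0 <= q * (2 * c - (1 - rho) * q) by rewrite mulr_ge0 //; lra.
  move=> h; have {h} : q * (2 * c - (1 - rho) * q) = 0 by lra.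
  by move/eqP; rewrite mulf_eq0 => /orP[/eqP //|/eqP]; lra.
move: key; rewrite q00 mul0r addr0 => key.
have {key} [D00 var00] : ewt y D = 0 /\ var = 0 by split; lra.
have yL u : u \in L -> y u = 0.
  have /eqP := q00; rewrite psumr_eq0 // => /allP /(_ u) h uL.
  by move: h; rewrite mem_index_enum uL => /(_ isT) /eqP.
have suppL u : 0 < y u -> u \notin L.
  by move=> yu; apply: contraTN yu => /yL ->; rewrite ltxx.
split.
- move=> u v yu yv; apply/idP/idP; first by apply: Cdisj; exact: suppL.
  move=> cuv; apply/negPn/negP => nG.
  have /eqP := D00; rewrite ewtE psumr_eq0; last first.
    by move=> w _; apply: sumr_ge0 => z _; rewrite !mulr_ge0.
  move=> /allP /(_ u (mem_index_enum u)); rewrite /= psumr_eq0; last first.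
    by move=> z _; rewrite !mulr_ge0.
  move=> /allP /(_ v (mem_index_enum v)).
  by rewrite /D !suppL // cuv nG /= mul1r mulf_eq0 !gt_eqF.
- move=> i; rewrite (wtID y _ L).
  have -> : wt y ([set u | cls u == i] :&: L) = 0.
    by apply: big1 => u; rewrite inE => /andP[_ /yL].
  move/eqP: var00; rewrite psumr_eq0; last by move=> j _; exact: sqr_ge0.
  move=> /allP /(_ i (mem_index_enum i)); rewrite /= sqrf_eq0 subr_eq0 => /eqP.
  by rewrite /C q00 => ->; lra.
- apply/eqP; rewrite eq_le GW andbT.
  by move: main ewtE1; rewrite ewtE2 ewtE3 sqC q00 D00 var00; lra.
Qed.

End WeightedStability.

(** * Counting ordered pairs *)

Section PairCounts.

Variable V : finType.

(** For a simple graph this is [2m], which avoids the integer halves of [num_edges] and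
    [edit_dist]. *)
Definition npairs (E : rel V) : nat := #|[set p : V * V | E p.1 p.2]|.

Lemma npairsE (E : rel V) : npairs E = (\sum_u #|E u|)%N.
Proof.
rewrite /npairs -sum1dep_card.
rewrite -(pair_big_dep xpredT (fun u v => E u v) (fun _ _ => 1%N)) /=.
by apply: eq_bigr => u _; rewrite sum1_card.
Qed.

Lemma npairs_sub (E F : rel V) : subrel E F -> (npairs E <= npairs F)%N.
Proof.
by move=> EF; apply/subset_leq_card/subsetP => p; rewrite !inE; exact: EF.
Qed.

Lemma npairs_deg_le (E : rel V) u : (#|E u| <= npairs E)%N.
Proof. by rewrite npairsE (bigD1 u) //= leq_addr. Qed.

End PairCounts.

(** * From the spectral bound to weighted stability *)

Section SpectralStability.

Variables (R : realFieldType) (V : finType) (x : V -> R) (lam : R).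
Variables (r t : nat) (G H : rel V) (P : 'I_r -> {set V}).
Hypothesis t_gt1 : (1 < t)%N.
Hypothesis r_gt1 : (1 < r)%N.
Hypothesis simpleG : simple_graph G.
Hypothesis HP : complete_multipartite_on P H.
Hypothesis Gfree : ~ contains_Krplus G r t.
Hypothesis x_ge0 : forall u, 0 <= x u.
Hypothesis x_norm : \sum_u x u ^+ 2 = 1.
Hypothesis lam_ge0 : 0 <= lam.
Hypothesis lam_le : forall u, lam * x u <= \sum_(v | G u v) x v.

(** Chosen so that, with [c = rho / 16], the bound on [2 * b] in the weighted argument is exactly
    [4 * b]. *)
Let N := (4096 * r ^ 3 * t)%N.
Let b : R := N%:R^-1.
Let D := npairs (fun u v => G u v != H u v).
Let M := npairs G.
Let rho : R := r%:R^-1.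
Hypothesis P_large : forall i, (8 * N <= #|P i|)%N.
Hypothesis D_le : D%:R <= b ^+ 4 / 8 * M%:R.
Hypothesis lam_large : (1 - rho) * M%:R <= lam ^+ 2.

Let y u := x u ^+ 2.
Let U := \bigcup_i P i.
Let xsum (E : rel V) := \sum_(p | E p.1 p.2) x p.1 * x p.2.

Let r_gt0 : 0 < r%:R :> R. Proof. by rewrite ltr0n (leq_trans _ r_gt1). Qed.
Let rrho : r%:R * rho = 1. Proof. by rewrite divff ?gt_eqF. Qed.
Let rho_gt0 : 0 < rho. Proof. by rewrite invr_gt0. Qed.
Let rho_le : rho <= 1/2.
Proof.
have: 2 <= r%:R :> R by rewrite (ler_nat R 2).
by move: rrho rho_gt0; nra.
Qed.
Let y_ge0 u : 0 <= y u. Proof. exact: sqr_ge0. Qed.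

Let N_ge : (4096 <= N)%N.
Proof.
by rewrite /N -mulnA leq_pmulr // muln_gt0 expn_gt0 (ltnW r_gt1) (ltnW t_gt1).
Qed.
Let N_gt0 : 0 < N%:R :> R. Proof. by rewrite ltr0n (leq_trans _ N_ge). Qed.
Let Nb : N%:R * b = 1. Proof. by rewrite divff ?gt_eqF. Qed.
Let b_gt0 : 0 < b. Proof. by rewrite invr_gt0. Qed.
Let b_le : b <= 1/4096.
Proof.
have: 4096%:R <= N%:R :> R by rewrite ler_nat.
by move: Nb b_gt0; nra.
Qed.
Let b2_le : b ^+ 2 <= b. Proof. by move: b_gt0 b_le; nra. Qed.
Let eps_le : b ^+ 4 / 8 <= b / 8.
Proof.
have -> : b ^+ 4 = b ^+ 2 * b ^+ 2 by ring.
by move: b2_le b_gt0 b_le; nra.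
Qed.

Lemma ewt_pairs (E : rel V) :
  ewt y E = \sum_(p | E p.1 p.2) (x p.1 * x p.2) ^+ 2.
Proof.
rewrite -(pair_big_dep xpredT (fun u v => E u v) (fun u v => (x u * x v) ^+ 2)) /=.
apply: eq_bigr => u _; rewrite mulr_sumr.
by apply: eq_bigr => v _; rewrite exprMn.
Qed.

Lemma xsum_sqr_le (E : rel V) : xsum E ^+ 2 <= (npairs E)%:R * ewt y E.
Proof. by rewrite ewt_pairs /npairs cardsE; exact: sqr_sum_le_card. Qed.

Lemma ewt_le1 (E : rel V) : ewt y E <= 1.
Proof.
rewrite /ewt -x_norm; apply: ler_sum => u _; rewrite -[leRHS]mulr1.
apply: ler_wpM2l => //; rewrite -x_norm; exact: sum_ge0_sub.
Qed.

Let U_gt0 : (0 < #|U|)%N.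
Proof.
apply: (@leq_trans (8 * N)); first by rewrite muln_gt0 (leq_trans _ N_ge).
apply: leq_trans (P_large (Ordinal (ltnW r_gt1))) _.
exact/subset_leq_card/bigcup_sup.
Qed.

(** Each vertex of [U] is joined in [H] to a whole other part. This makes [#|U|] a small fraction of
    [M]. *)
Lemma npairsH_ge : (8 * N * #|U| <= npairs H)%N.
Proof.
rewrite npairsE (bigID (mem U)) /= -sum1_card mulnC big_distrl /=.
apply: leq_trans (leq_addr _ _); apply: leq_sum => u /bigcupP[i _ ui].
rewrite mul1n; have [j ji] : exists j, j != i.
  pose i0 : 'I_r := Ordinal (ltnW r_gt1); pose i1 : 'I_r := Ordinal r_gt1.
  by case: (eqVneq i i0) => [->|]; [exists i1|exists i0; rewrite eq_sym].
apply: leq_trans (P_large j) _; apply/subset_leq_card/subsetP => v vj.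
by apply: (multipartite_edge HP _ ui vj); rewrite eq_sym.
Qed.

Lemma npairsH_le : (npairs H <= M + D)%N.
Proof.
rewrite /M /D !npairsE -big_split /=; apply: leq_sum => u _.
rewrite -cardUI; apply: leq_trans (leq_addr _ _).
by apply/subset_leq_card/subsetP => v; rewrite !inE !unfold_in /= => ->; case: (G u v).
Qed.

Lemma degG_le u : (#|G u| <= #|U| + D)%N.
Proof.
apply: (@leq_trans (#|H u| + #|fun v => G u v != H u v|)).
  rewrite -cardUI; apply: leq_trans (leq_addr _ _).
  by apply/subset_leq_card/subsetP => v; rewrite !inE !unfold_in /= => ->; case: (H u v).
apply: leq_add; last exact: (npairs_deg_le (fun u v => G u v != H u v)).
apply/subset_leq_card/subsetP => v; rewrite unfold_in HP.2.
by case/existsP=> i /existsP[j /and3P[_ _ vj]]; apply/bigcupP; exists j.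
Qed.

Let U_le : #|U|%:R * 8 <= b * (M%:R + D%:R).
Proof.
have : (8 * N * #|U|)%:R <= (M + D)%:R :> R.
  by rewrite ler_nat (leq_trans npairsH_ge) // npairsH_le.
rewrite natrD (natrM _ (8 * N)) (natrM _ 8) => h.
have := ler_wpM2l (ltW b_gt0) h; have := Nb.
have -> : b * (8%:R * N%:R * #|U|%:R) = (N%:R * b) * (#|U|%:R * 8) by ring.
by move=> ->; rewrite mul1r.
Qed.

Let M_gt0 : 0 < M%:R :> R.
Proof.
rewrite lt_def ler0n andbT; apply/eqP => M0; move: D_le U_le; rewrite M0 mulr0.
have : 1 <= #|U|%:R :> R by rewrite (ler_nat R 1) U_gt0.
by move: b_gt0; nra.
Qed.

Let lam2_ge : M%:R <= 2 * lam ^+ 2.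
Proof. by move: lam_large rho_le M_gt0; nra. Qed.

(** Cauchy-Schwarz gives [lam ^+ 2 * y u <= #|G u|]; the degree is at most [#|U| + D], both small
    fractions of [M <= 2 * lam ^+ 2]. *)
Lemma y_le u : y u <= b.
Proof.
have lamy : lam ^+ 2 * y u <= #|G u|%:R.
  rewrite /y -exprMn; apply: (@le_trans _ _ ((\sum_(v | G u v) x v) ^+ 2)).
    by rewrite lerXn2r ?nnegrE ?mulr_ge0 ?sumr_ge0.
  apply: le_trans (sqr_sum_le_card _ _) _.
  rewrite -[leRHS]mulr1; apply: ler_wpM2l => //.
  by rewrite -x_norm; apply: sum_ge0_sub => // v; exact: sqr_ge0.
have degR : #|G u|%:R <= #|U|%:R + D%:R :> R by rewrite -natrD ler_nat degG_le.
have [//|yb] := lerP; exfalso.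
have : M%:R * b < 2 * lam ^+ 2 * y u.
  apply: (@lt_le_trans _ _ (M%:R * y u)); first by rewrite ltr_pM2l ?M_gt0.
  exact: ler_wpM2r.
have := D_le; have := ler_wpM2r (ltW M_gt0) eps_le.
have := M_gt0; move: U_le b_le b_gt0 (ler0n R D).
by nra.
Qed.

Lemma lam_le_xsum : lam <= xsum G.
Proof.
rewrite -[lam]mulr1 -x_norm mulr_sumr /xsum.
rewrite -(pair_big_dep xpredT (fun u v => G u v) (fun u v => x u * x v)) /=.
apply: ler_sum => u _; rewrite -mulr_sumr expr2 mulrCA.
exact: ler_wpM2l.
Qed.

Let GH u v := G u v && H u v.
Let GnH u v := G u v && ~~ H u v.
Let HnG u v := H u v && ~~ G u v.

Lemma xsum_split : xsum G = xsum GH + xsum GnH.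
Proof. by rewrite /xsum (bigID (fun p => H p.1 p.2)). Qed.

Lemma ewt_split : ewt y H = ewt y GH + ewt y HnG.
Proof.
rewrite !ewt_pairs (bigID (fun p => G p.1 p.2)) /=; congr (_ + _).
by apply: eq_bigl => p; rewrite andbC.
Qed.

Let lam_gt0 : 0 < lam.
Proof.
rewrite lt_def lam_ge0 andbT; apply/eqP => l0.
by move: lam2_ge; rewrite l0 expr0n mulr0 leNgt M_gt0.
Qed.

(** Cauchy-Schwarz twice: the at most [D] pairs of [G] outside [H] carry at most [b ^+ 2 / 2 * lam]
    of [xsum G], and the rest is compared with [ewt y GH] over at most [M] pairs. *)
Lemma ewtGH_ge : 1 - rho - b ^+ 2 <= ewt y GH.
Proof.
have SGnH : xsum GnH <= b ^+ 2 / 2 * lam.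
  have S0 : 0 <= xsum GnH by apply: sumr_ge0 => p _; rewrite mulr_ge0.
  have l0 : 0 <= b ^+ 2 / 2 * lam by rewrite mulr_ge0 // divr_ge0 // sqr_ge0.
  rewrite -(@ler_pXn2r _ 2) ?nnegrE //.
  apply: le_trans (xsum_sqr_le _) _.
  apply: (@le_trans _ _ D%:R).
    rewrite -[leRHS]mulr1; apply: ler_pM; rewrite ?ler0n ?ewt_le1 //.
      by apply: sumr_ge0 => u _; rewrite mulr_ge0 ?wdeg_ge0.
    rewrite ler_nat; apply: npairs_sub => u v.
    by rewrite /GnH; case: (G u v); case: (H u v).
  apply: (le_trans D_le).
  have -> : (b ^+ 2 / 2 * lam) ^+ 2 = b ^+ 4 / 8 * (2 * lam ^+ 2) by field.
  by apply: ler_wpM2l => //; rewrite divr_ge0 // exprn_ge0 // ltW.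
have SGH : (1 - b ^+ 2 / 2) * lam <= xsum GH.
  by have := lam_le_xsum; rewrite xsum_split; lra.
have SGH2 : ((1 - b ^+ 2 / 2) * lam) ^+ 2 <= xsum GH ^+ 2.
  have b21 : 0 <= 1 - b ^+ 2 / 2 by move: b2_le b_le; lra.
  by rewrite lerXn2r ?nnegrE ?mulr_ge0 // (le_trans _ SGH) // mulr_ge0.
have : xsum GH ^+ 2 <= M%:R * ewt y GH.
  apply: le_trans (xsum_sqr_le _) _; apply: ler_wpM2r.
    by apply: sumr_ge0 => u _; rewrite mulr_ge0 ?wdeg_ge0.
  by rewrite ler_nat; apply: npairs_sub => u v /andP[].
move/(le_trans SGH2); rewrite exprMn => h.
have : (1 - b ^+ 2) * ((1 - rho) * M%:R) <= M%:R * ewt y GH.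
  apply: le_trans h; apply: (@le_trans _ _ ((1 - b ^+ 2) * lam ^+ 2)).
    by apply: ler_wpM2l => //; move: b2_le b_le; lra.
  by apply: ler_wpM2r; [exact: sqr_ge0 | have := sqr_ge0 (b ^+ 2 / 2); lra].
have -> : (1 - b ^+ 2) * ((1 - rho) * M%:R) = M%:R * ((1 - b ^+ 2) * (1 - rho)).
  by ring.
rewrite ler_pM2l ?M_gt0 //; apply: le_trans.
by have := mulr_ge0 (sqr_ge0 b) (ltW rho_gt0); lra.
Qed.

Lemma wtU_le1 : wt y U <= 1.
Proof. by rewrite -x_norm; exact: sum_ge0_sub. Qed.

Lemma ewtH : ewt y H = wt y U ^+ 2 - \sum_i wt y (P i) ^+ 2.
Proof.
rewrite /ewt (bigID (mem U)) /= [X in _ + X]big1 => [|u uNU]; last first.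
  rewrite /wdeg big_pred0 ?mulr0 // => v; apply: contraNF uNU.
  rewrite HP.2 => /existsP[i /existsP[j /and3P[_ ui _]]].
  by apply/bigcupP; exists i.
rewrite addr0 partition_disjoint_bigcup /=; last by move=> i j ij; exact: HP.1.
transitivity (\sum_i (wt y (P i) * wt y U - wt y (P i) ^+ 2)).
  apply: eq_bigr => i _; rewrite expr2 -mulrBr mulr_suml; apply: eq_bigr => u ui.
  congr (_ * _).
  rewrite (wtID y U (P i)) (setIidPr _) ?bigcup_sup // addrAC subrr add0r.
  by apply: eq_bigl => v; rewrite (multipartite_nbhd HP ui).
by rewrite sumrB -mulr_suml -(wt_cover HP) expr2.
Qed.

Lemma wtP_near i : `|wt y (P i) - rho| <= b.
Proof.
have sq : \sum_i (wt y (P i) - rho) ^+ 2 <= b ^+ 2.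
  rewrite sum_sqr_shift card_ord -(wt_cover HP) -/U.
  have := ewtGH_ge; have := ewt_split; rewrite ewtH.
  have : 0 <= ewt y HnG by apply: sumr_ge0 => u _; rewrite mulr_ge0 ?wdeg_ge0.
  have -> : r%:R * rho ^+ 2 = rho by rewrite expr2 mulrA rrho mul1r.
  have := wtU_le1; have := wt_ge0 y_ge0 U; have := rho_le.
  set s := wt y U => rh s0 s1.
  (* This is what remains of the sum of squared deviations beyond [b ^+ 2]; its sign follows from
     [s <= 1] and [rho <= 1/2]. *)
  have : (s - 1) * (s + 1 - 2 * rho) <= 0 by nra.
  by lra.
rewrite -(@ler_pXn2r _ 2) ?nnegrE ?(ltW b_gt0) // real_normK ?num_real //.
apply: le_trans sq; rewrite (bigD1 i) //= lerDl.
by apply: sumr_ge0 => j _; exact: sqr_ge0.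
Qed.

(** By convexity an [r]-partite graph of total weight at most 1 has edge weight at most [1 - rho],
    and the edges shared with [G] leave only [b ^+ 2]. *)
Lemma ewtHnG_le : ewt y HnG <= b.
Proof.
suff : ewt y H <= 1 - rho by rewrite ewt_split; have := ewtGH_ge; move: b2_le; lra.
rewrite ewtH sum_sqr_dev card_ord -(wt_cover HP) -/U -/rho.
set var := \sum_i _; have var0 : 0 <= var by apply: sumr_ge0 => i _; exact: sqr_ge0.
have : wt y U ^+ 2 <= 1 by rewrite expr_le1 ?wt_ge0 ?wtU_le1.
by have := rho_le; nra.
Qed.

Lemma ewtG_ge : 1 - rho <= ewt y G.
Proof.
have : lam ^+ 2 <= M%:R * ewt y G.
  apply: le_trans (xsum_sqr_le _); rewrite lerXn2r ?nnegrE ?lam_le_xsum //.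
  exact: le_trans lam_le_xsum.
move/(le_trans lam_large); rewrite [leLHS]mulrC ler_pM2l //; exact: M_gt0.
Qed.

Let b_lt : 2 * b < rho / 16 / 2 * (rho / 16 / (2 * (r * t)%:R)).
Proof.
have r0 : r%:R != 0 :> R by rewrite gt_eqF.
have t0 : 0 < t%:R :> R by rewrite ltr0n ltnW.
have -> : rho / 16 / 2 * (rho / 16 / (2 * (r * t)%:R)) = 4 * b.
  rewrite /b /rho /N; field.
  by rewrite r0 gt_eqF.
by move: b_gt0; lra.
Qed.

Let rb_le : r%:R * b <= rho / 1000.
Proof.
have r0 : r%:R != 0 :> R by rewrite gt_eqF.
have t1 : 1 <= t%:R :> R by rewrite (ler_nat R 1) ltnW.
have r1 : 1 <= r%:R :> R by rewrite (ler_nat R 1) ltnW.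
have e : rho = 4096 * (r%:R * b * (r%:R * t%:R)).
  by rewrite /b /rho /N; field; rewrite r0 gt_eqF // ltr0n ltnW.
have rt1 : 1 <= r%:R * t%:R :> R by rewrite mulr_ege1.
have rb0 : 0 <= r%:R * b by rewrite mulr_ge0 ?ltW.
rewrite e; have := ler_wpM2l rb0 rt1; rewrite mulr1; lra.
Qed.

(* Equality in Cauchy-Schwarz makes [x u * x v] constant along the edges; with at
   least three classes this forces [x] to be constant on its support. *)
Lemma spectral_stability : lam ^+ 2 = (1 - rho) * M%:R /\
  (if r == 2%N then is_complete_multipartite 2 G
   else is_regular_complete_multipartite r G).
Proof.
have [cls [Gcls wcls eG]] := weighted_stability y_ge0 x_norm t_gt1 r_gt1 simpleG
  HP Gfree y_le b_lt rb_le wtP_near ewtHnG_le ewtG_ge.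
have SM : xsum G ^+ 2 <= (1 - rho) * M%:R.
  by apply: le_trans (xsum_sqr_le _) _; rewrite eG mulrC.
have lamS : lam ^+ 2 <= xsum G ^+ 2.
  by rewrite lerXn2r ?nnegrE ?lam_le_xsum // (le_trans lam_ge0) // lam_le_xsum.
have lamE : lam ^+ 2 = (1 - rho) * M%:R.
  by apply/eqP; rewrite eq_le lam_large (le_trans lamS).
split=> //.
have SE : xsum G ^+ 2 / M%:R = 1 - rho.
  have -> : xsum G ^+ 2 = (1 - rho) * M%:R.
    by apply/eqP; rewrite eq_le SM (le_trans lam_large).
  by rewrite mulfK // gt_eqF // M_gt0.
pose kap := xsum G / M%:R.
have kap_gt0 : 0 < kap.
  by rewrite divr_gt0 ?M_gt0 // (lt_le_trans lam_gt0) // lam_le_xsum.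
have edge_kap u v : G u v -> x u * x v = kap.
  (* The sum of squares equals its mean term [1 - rho], so every deviation from the mean [kap] is
     zero. *)
  move=> Guv; have := ewt_pairs G.
  rewrite sum_sqr_dev -/(xsum G) -cardsE -/(npairs G) -/M SE eG -/kap.
  move/eqP; rewrite -{1}[1 - rho]addr0 (inj_eq (addrI _)) eq_sym psumr_eq0; last first.
    by move=> p _; exact: sqr_ge0.
  move=> /allP /(_ (u, v) (mem_index_enum _)) /=.
  by rewrite Guv sqrf_eq0 subr_eq0 => /eqP.
(* Vertices of weight zero are dropped; they are isolated because [kap] is positive. *)
pose Q i := [set u | (cls u == i) && (0 < y u)].
have supp_edge u v : G u v -> 0 < y u.
  move=> /edge_kap xuv; rewrite lt_def y_ge0 andbT sqrf_eq0.
  by apply: contraTneq kap_gt0 => xu0; rewrite -xuv xu0 mul0r ltxx.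
have QG : complete_multipartite_on Q G.
  split=> [i j ij|u v].
    apply/pred0P => u /=; rewrite !inE; apply/negP => /andP[/andP[/eqP ui _]].
    by rewrite ui (negPf ij).
  apply/idP/existsP => [Guv|[i /existsP[j /and3P[ij]]]].
    have yu := supp_edge _ _ Guv.
    have yv : 0 < y v by apply: (supp_edge v u); rewrite simpleG.1.
    exists (cls u); apply/existsP; exists (cls v).
    by rewrite -Gcls // Guv !inE !eqxx yu yv.
  rewrite !inE => /andP[/eqP ui yu] /andP[/eqP vj yv].
  by rewrite Gcls // ui vj.
have wtQ i : wt y (Q i) = rho.
  rewrite -[rho](wcls i) /wt [RHS](bigID (fun u => 0 < y u)) /= [X in _ + X]big1.
    by rewrite addr0; apply: eq_bigl => u; rewrite !inE.
  by move=> u /andP[_]; rewrite -leNgt => yu0; apply/eqP; rewrite eq_le yu0 y_ge0.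
have Q0 i : Q i != set0.
  by apply/eqP => Qi0; have := wtQ i; rewrite Qi0 /wt big_set0; move: rho_gt0; lra.
case: eqP => [<-|/eqP r2]; first by exists Q.
exists Q; split=> //; split=> // i j.
have QG_edge := multipartite_edge QG.
(* A vertex of a third class is a common neighbour, through which two values of [x] are compared. *)
have third (i' j' : 'I_r) : exists k, (k != i') && (k != j').
  have r_gt2 : (2 < r)%N by rewrite ltn_neqAle eq_sym r2.
  have: (#|[set i'; j']| < #|'I_r|)%N.
    by rewrite card_ord (leq_ltn_trans _ r_gt2) // cards2; case: (_ != _).
  rewrite ltnNge => /negP h.
  case: (boolP [exists k, (k != i') && (k != j')]) => [/existsP //|/existsPn hk].
  case: h.
  apply/subset_leq_card/subsetP => k _; move: (hk k); rewrite negb_and !negbK !inE.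
  exact.
have xconst u v i' j' : u \in Q i' -> v \in Q j' -> x u = x v.
  move=> ui vj; have [k /andP[ki kj]] := third i' j'.
  have [w wk] := set0Pn _ (Q0 k).
  have Gwu := QG_edge _ _ _ _ ki wk ui; have Gwv := QG_edge _ _ _ _ kj wk vj.
  apply: (@mulfI _ (x w)); last by rewrite (edge_kap _ _ Gwu) (edge_kap _ _ Gwv).
  by move: wk; rewrite inE => /andP[_]; rewrite /y lt_def sqrf_eq0 => /andP[].
have [w wi] := set0Pn _ (Q0 i).
have wtQ_card k : wt y (Q k) = #|Q k|%:R * y w.
  rewrite mulr_natl -sumr_const; apply: eq_bigr => u uk.
  by rewrite /y (xconst u w k i).
have yw : y w != 0 by move: wi; rewrite inE => /andP[_ /gt_eqF ->].
by apply/eqP; rewrite -(eqr_nat R) -(inj_eq (mulIf yw)) -!wtQ_card !wtQ.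
Qed.

End SpectralStability.

(** * Parity of pair counts and the case [t = 1] *)

Lemma npairs_half (V : finType) (E : rel V) :
  symmetric E -> irreflexive E -> (npairs E = 2 * (npairs E %/ 2))%N.
Proof.
move=> symE irrE.
pose A := [set p : V * V | E p.1 p.2 & (enum_rank p.1 < enum_rank p.2)%N].
pose B := [set p : V * V | E p.1 p.2 & (enum_rank p.2 < enum_rank p.1)%N].
suff -> : npairs E = (2 * #|A|)%N by rewrite mulKn.
have swapK : involutive (fun p : V * V => (p.2, p.1)) by case.
have -> : npairs E = (#|A| + #|B|)%N.
  rewrite -cardsUI; have -> : A :&: B = set0.
    apply/setP => p; rewrite !inE; apply/negP => /andP[/andP[_ h] /andP[_]].
    by rewrite ltnNge ltnW.
  rewrite cards0 addn0; apply: eq_card => p; rewrite !inE -andb_orr -neq_ltn.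
  apply/esym/andb_idr; apply: contraTneq => /val_inj/enum_rank_inj ->.
  by rewrite irrE.
rewrite mul2n -addnn; congr (_ + _)%N.
rewrite -(card_imset _ (inv_inj swapK)); apply: eq_card => p.
apply/imsetP/idP => [[q + ->]|pA].
  by rewrite !inE /= symE.
by exists (p.2, p.1); [move: pA; rewrite !inE /= symE | case: p {pA}].
Qed.

(** Both ends of the inner edge and one vertex from each other part form a [K_{r+1}]. *)
Lemma contains_Krplus_2_1 (V : finType) (G : rel V) (r : nat) :
  symmetric G -> contains_Krplus G r 2 -> contains_Krplus G r 1.
Proof.
move=> symG [f [injf [Gf [i [a [b [ab Gab]]]]]]].
pose g (k : 'I_r.+1) := if unlift ord_max k is Some j then f (j, a) else f (i, b).
have fab j : f (j, a) != f (i, b).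
  by rewrite (inj_eq injf) xpair_eqE negb_and ab orbT.
have Gib j : G (f (j, a)) (f (i, b)).
  by have [->//|ji] := eqVneq j i; exact: Gf.
exists g; split=> [k l|k l]; rewrite /g;
  case: (unliftP ord_max k) => [k' ->|->]; case: (unliftP ord_max l) => [l' ->|->] //.
- by move/injf => [->].
- by move/eqP; rewrite (negPf (fab _)).
- by move/eqP; rewrite eq_sym (negPf (fab _)).
- by rewrite (inj_eq lift_inj) => kl; exact: Gf.
- by rewrite symG.
- by rewrite eqxx.
Qed.

(** * Eigenvalues of complete multipartite graphs *)

Section MultipartiteSpectrum.

Variables (V : finType) (r : nat) (Q : 'I_r -> {set V}) (G : rel V).
Hypothesis QG : complete_multipartite_on Q G.

Lemma multipartite_indicator (u v : V) :
  (G u v)%:R = \sum_i \sum_(j | j != i) (u \in Q i)%:R * (v \in Q j)%:R :> algC.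
Proof.
have [/bigcupP[i _ ui]|uN] := boolP (u \in \bigcup_i Q i); last first.
  rewrite big1 => [|i _]; last first.
    have -> : u \in Q i = false.
      by apply: contraNF uN => ui; apply/bigcupP; exists i.
    by rewrite big1 // => j _; rewrite mul0r.
  suff -> : G u v = false by [].
  apply: contraNF uN; rewrite QG.2 => /existsP[i /existsP[j /and3P[_ ui _]]].
  by apply/bigcupP; exists i.
rewrite (bigD1 i) //= [X in _ + X]big1 ?addr0 => [|k ki]; last first.
  rewrite big1 // => j _.
  by rewrite (disjointFr (QG.1 i k _) ui) ?mul0r // eq_sym.
rewrite ui; have [Guv|nG] := boolP (G u v).
  have := Guv; rewrite (multipartite_nbhd QG ui) /= inE => /andP[vNi /bigcupP[j _ vj]].
  have ji : j != i by apply: contraNneq vNi => <-.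
  rewrite (bigD1 j) //= vj mulr1 big1 ?addr0 // => k /andP[_ kj].
  by rewrite (disjointFr (QG.1 j k _) vj) ?mulr0 // eq_sym.
rewrite big1 // => j ji; have [vj|] := boolP (v \in Q j); last by rewrite mulr0.
by case/negP: nG; apply: (multipartite_edge QG _ ui vj); rewrite eq_sym.
Qed.

Lemma sum_part (i : 'I_r) : \sum_v (v \in Q i)%:R = #|Q i|%:R :> algC.
Proof.
by rewrite -natr_sum -sum1_card [in RHS]big_mkcond.
Qed.

Lemma npairs_multipartite :
  (npairs G)%:R = \sum_i \sum_(j | j != i) #|Q i|%:R * #|Q j|%:R :> algC.
Proof.
have -> : (npairs G)%:R = \sum_u \sum_v (G u v)%:R :> algC.
  rewrite npairsE natr_sum; apply: eq_bigr => u _.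
  rewrite -sum1_card natr_sum big_mkcond; apply: eq_bigr => v _.
  by rewrite unfold_in; case: (G u v).
under eq_bigr => u _ do under eq_bigr => v _ do rewrite multipartite_indicator.
under eq_bigr => u _ do rewrite exchange_big.
rewrite exchange_big; apply: eq_bigr => i _.
under eq_bigr => u _ do rewrite exchange_big.
rewrite exchange_big; apply: eq_bigr => j _ /=.
rewrite -!sum_part mulr_suml; apply: eq_bigr => u _.
by rewrite mulr_sumr.
Qed.

(** An eigenvector of the quotient matrix lifts to one that is constant on each part and zero
    outside the parts. *)
Lemma multipartite_eigenvalue (al : 'I_r -> algC) (mu : algC) (k : 'I_r) :
  (forall i, \sum_(j | j != i) #|Q j|%:R * al j = mu * al i) ->
  al k != 0 -> Q k != set0 -> eigenvalue (adj_mx G) mu.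
Proof.
move=> almu alk /set0Pn[w wk].
pose z v := \sum_i (v \in Q i)%:R * al i.
have zQ i v : (v \in Q i)%:R * z v = (v \in Q i)%:R * al i.
  have [vi|] := boolP (v \in Q i); last by rewrite !mul0r.
  rewrite !mul1r /z (bigD1 i) //= vi mul1r big1 ?addr0 // => j ji.
  by rewrite (disjointFr (QG.1 i j _) vi) ?mul0r // eq_sym.
apply/eigenvalueP; exists (\row_i z (enum_val i)); last first.
  apply/eqP => /rowP /(_ (enum_rank w)); rewrite !mxE enum_rankK => zw0.
  by have := zQ k w; rewrite wk zw0 !mul1r => alk0; rewrite -alk0 eqxx in alk.
apply/rowP => p; rewrite !mxE; set u := enum_val p.
transitivity (\sum_v z v * (G v u)%:R).
  rewrite [RHS](reindex (@enum_val V predT)) /=; last exact/onW_bij/enum_val_bij.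
  by apply: eq_bigr => q _; rewrite !mxE.
transitivity (\sum_j \sum_(i | i != j) (u \in Q j)%:R * (#|Q i|%:R * al i)).
  transitivity (\sum_v \sum_i \sum_(j | i != j)
      (u \in Q j)%:R * (al i * (v \in Q i)%:R)).
    apply: eq_bigr => v _; rewrite multipartite_indicator mulr_sumr.
    apply: eq_bigr => i _; rewrite mulr_sumr; apply: eq_big => [j|j _].
      by rewrite eq_sym.
    by rewrite mulrA [z v * _]mulrC zQ mulrC [_ * al i]mulrC.
  rewrite exchange_big; under eq_bigr => i _ do rewrite exchange_big.
  rewrite (exchange_big_dep xpredT) //=; apply: eq_bigr => j _; apply: eq_bigr => i _.
  by rewrite -mulr_sumr -mulr_sumr sum_part [al i * _]mulrC.
rewrite mulr_sumr; apply: eq_bigr => j _.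
by rewrite -mulr_sumr almu mulrCA.
Qed.

End MultipartiteSpectrum.

Lemma bipartite_spectral_radius_ge (V : finType) (G : rel V) (l : algC) :
  is_complete_multipartite 2 G -> is_spectral_radius (adj_mx G) l ->
  (1 - 2^-1) * (npairs G)%:R <= l ^+ 2.
Proof.
move=> [Q [Q0 QG]] [_ lmax].
pose q (i : 'I_2) : algC := sqrtC #|Q i|%:R.
have q2 i : q i ^+ 2 = #|Q i|%:R by rewrite sqrtCK.
have q_ge0 i : 0 <= q i by rewrite sqrtC_ge0.
pose i1 : 'I_2 := lift ord0 ord0.
have /lmax : eigenvalue (adj_mx G) (q ord0 * q i1).
  (* Each part receives the square root of the size of the other one. *)
  apply: (@multipartite_eigenvalue _ _ Q G QG
    (fun i => if i == ord0 then q i1 else q ord0) _ ord0) => //.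
    move=> i; rewrite big_mkcond !big_ord_recl big_ord0 -!q2 /=.
    by case: (unliftP ord0 i) => [j|] -> /=; rewrite ?ord1 /=; ring.
  by rewrite eqxx sqrtC_eq0 pnatr_eq0 cards_eq0.
rewrite ger0_norm ?mulr_ge0 // => ql.
rewrite (npairs_multipartite QG).
have -> : \sum_i \sum_(j | j != i) #|Q i|%:R * #|Q j|%:R = 2 * (q ord0 * q i1) ^+ 2.
  rewrite !big_ord_recl big_ord0 !(big_mkcond (fun j => j != _)).
  by rewrite !big_ord_recl !big_ord0 /= -!q2; ring.
have -> : (1 - 2^-1) * (2 * (q ord0 * q i1) ^+ 2) = (q ord0 * q i1) ^+ 2 by field.
by rewrite lerXn2r ?nnegrE ?mulr_ge0 // (le_trans _ ql) ?mulr_ge0.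
Qed.

Lemma regular_spectral_radius_ge (V : finType) (r : nat) (G : rel V) (l : algC) :
  (0 < r)%N ->
  is_regular_complete_multipartite r G -> is_spectral_radius (adj_mx G) l ->
  (1 - r%:R^-1) * (npairs G)%:R <= l ^+ 2.
Proof.
move=> r_gt0 [Q [Q0 [Qs QG]]] [_ lmax].
pose i0 : 'I_r := Ordinal r_gt0; pose s : algC := #|Q i0|%:R.
have sumC (i : 'I_r) (c : algC) : \sum_(j | j != i) c = (r.-1)%:R * c.
  by rewrite sumr_const cardC1 card_ord mulr_natl.
have /lmax : eigenvalue (adj_mx G) ((r.-1)%:R * s).
  apply: (@multipartite_eigenvalue _ _ Q G QG (fun=> 1) _ i0) => [i||//]; last first.
    exact: oner_neq0.
  by rewrite mulr1 -(sumC i); apply: eq_bigr => j _; rewrite mulr1 /s (Qs j i0).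
have s0 : 0 <= (r.-1)%:R * s by rewrite mulr_ge0.
rewrite ger0_norm // => sl.
rewrite (npairs_multipartite QG).
have -> : \sum_i \sum_(j | j != i) #|Q i|%:R * #|Q j|%:R
    = r%:R * ((r.-1)%:R * s ^+ 2).
  transitivity (\sum_(i < r) (r.-1)%:R * s ^+ 2); last first.
    by rewrite sumr_const card_ord [RHS]mulr_natl.
  apply: eq_bigr => i _.
  by rewrite -(sumC i); apply: eq_bigr => j _; rewrite (Qs i i0) (Qs j i0).
have -> : (1 - r%:R^-1) * (r%:R * ((r.-1)%:R * s ^+ 2)) = ((r.-1)%:R * s) ^+ 2.
  have r0 : r%:R != 0 :> algC by rewrite pnatr_eq0 -lt0n.
  have -> : (r.-1)%:R = r%:R - 1 :> algC by rewrite -{2}(prednK r_gt0) -natr1 addrK.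
  by field.
by rewrite lerXn2r ?nnegrE // (le_trans _ sl).
Qed.

(** * Passage to a nonnegative real vector *)

(** Absolute values of the entries of an eigenvector turn the eigenvalue equation into an
    inequality, by the triangle inequality. They lie in [algR], whose order is total. *)
Lemma spectral_radius_real_vector (V : finType) (G : rel V) (l : algC) :
  symmetric G -> is_spectral_radius (adj_mx G) l ->
  exists (lam : algR) (x : V -> algR), [/\ val lam = l, 0 <= lam,
    forall u, 0 <= x u, \sum_u x u ^+ 2 = 1 &
    forall u, lam * x u <= \sum_(v | G u v) x v].
Proof.
move=> symG [[a [/eigenvalueP[w wA w0] al]] _].
pose z u := w 0 (enum_rank u).
pose n2 := \sum_u `|z u| ^+ 2; pose s := sqrtC n2.
have n2_ge0 : 0 <= n2 by apply: sumr_ge0 => u _; rewrite exprn_ge0.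
have s_ge0 : 0 <= s by rewrite sqrtC_ge0.
have n2_neq0 : n2 != 0.
  apply: contraNneq w0 => /eqP; rewrite psumr_eq0 => [/allP zn0|u _]; last first.
    by rewrite exprn_ge0.
  apply/eqP/rowP => i; rewrite mxE -(enum_valK i).
  have /(_ (mem_index_enum _)) := zn0 (enum_val i).
  by rewrite /= expf_eq0 /= normr_eq0 => /eqP.
have zA u : `|a| * `|z u| <= \sum_(v | G u v) `|z v|.
  have := congr1 (fun v : 'rV_#|V| => v 0 (enum_rank u)) wA; rewrite /= !mxE => wAu.
  rewrite -normrM -[a * z u]wAu; apply: le_trans (ler_norm_sum _ _ _) _.
  rewrite (reindex (@enum_rank V)) /=; last exact/onW_bij/enum_rank_bij.
  rewrite [leRHS]big_mkcond /=; apply: ler_sum => v _.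
  rewrite !mxE !enum_rankK symG; case: (G u v); first by rewrite mulr1.
  by rewrite mulr0 normr0.
exists (in_algR (normr_real a)), (fun u => in_algR (normr_real (z u / s))).
have valx u : val (in_algR (normr_real (z u / s))) = `|z u| / s.
  by rewrite /= normrM normfV (ger0_norm s_ge0).
split=> //.
- by rewrite -[_ <= _]/(0 <= `|a|).
- by move=> u; rewrite -[_ <= _]/(0 <= `|z u / s|).
- apply: val_inj; rewrite -[LHS]/(algRval _) rmorph_sum.
  transitivity (\sum_u (`|z u| / s) ^+ 2).
    by apply: eq_bigr => u _; rewrite rmorphXn -valx.
  under eq_bigr => u _ do rewrite exprMn exprVn sqrtCK.
  by rewrite -mulr_suml divff.
- move=> u.
  have -> : forall p q : algR, (p <= q) = (val p <= val q) by [].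
  rewrite -[leLHS]/(algRval _) -[leRHS]/(algRval _) rmorphM rmorph_sum.
  rewrite [leRHS](eq_bigr (fun v => `|z v| / s)); last by move=> v _; exact: valx.
  rewrite [X in _ * X <= _]valx -mulr_suml mulrA.
  by apply: ler_wpM2r; rewrite ?invr_ge0.
Qed.

(** * Choice of constants and conclusion *)

Theorem theorem3p1 :
  forall (t r : nat), (0 < t)%N -> (2 <= r)%N ->
  exists (eps : algC) (n0 : nat), 0 < eps /\
  forall (V : finType) (G : rel V),
    simple_graph G ->
    ~ contains_Krplus G r t ->
    forall (P : 'I_r -> {set V}) (H : rel V),
      complete_multipartite_on P H ->
      (forall i, (n0 <= #|P i|)%N) ->
      ((3 <= r)%N -> forall i j, #|P i| = #|P j|) ->
      (edit_dist G H)%:R <= eps * (num_edges G)%:R ->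
      forall l : algC, is_spectral_radius (adj_mx G) l ->
        l ^+ 2 <= (1 - r%:R^-1) * (2 * (num_edges G)%:R) /\
        (l ^+ 2 = (1 - r%:R^-1) * (2 * (num_edges G)%:R) <->
          (if r == 2%N then is_complete_multipartite 2 G
           else is_regular_complete_multipartite r G)).
Proof.
move=> t r t_gt0 r_gt1.
(* A [K_{r+1}]-free graph is also [K_r^+[2]]-free, so [t = 1] is handled with [t' = 2]. *)
pose t' := if t == 1%N then 2 else t.
have t'_gt1 : (1 < t')%N by rewrite /t'; case: t t_gt0 {t'} => [|[|t]].
pose N := (4096 * r ^ 3 * t')%N.
have N_gt0 : (0 < N)%N.
  by rewrite /N muln_gt0 muln_gt0 expn_gt0 (ltnW r_gt1) (ltnW t'_gt1).
exists ((N%:R^-1) ^+ 4 / 8), (8 * N)%N; split.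
  by rewrite divr_gt0 ?exprn_gt0 ?invr_gt0 ?ltr0n.
move=> V G simpleG Gfree P H HP P_large _ edit l lG.
have Gfree' : ~ contains_Krplus G r t'.
  rewrite /t'; case: eqP => [t1|_] //; rewrite t1 in Gfree.
  by move/(contains_Krplus_2_1 simpleG.1).
have numE : 2 * (num_edges G)%:R = (npairs G)%:R :> algC.
  by rewrite -natrM [in RHS](npairs_half simpleG.1 simpleG.2).
have editE : 2 * (edit_dist G H)%:R = (npairs (fun u v => G u v != H u v))%:R :> algC.
  rewrite -natrM [in RHS]npairs_half // => [u v|u].
    by rewrite simpleG.1 (multipartite_sym HP).
  by rewrite simpleG.2 (multipartite_irr HP).
have [lam [x [lamE lam_ge0 x_ge0 x_norm lam_le]]] :=
  spectral_radius_real_vector simpleG.1 lG.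
have editR : (npairs (fun u v => G u v != H u v))%:R
    <= (N%:R^-1) ^+ 4 / 8 * (npairs G)%:R :> algR.
  have -> : forall p q : algR, (p <= q) = (val p <= val q) by [].
  rewrite -[leLHS]/(algRval _) -[leRHS]/(algRval _).
  rewrite !(rmorphM algRval, rmorphXn algRval, fmorphV algRval, rmorph_nat algRval).
  rewrite -editE -numE mulrCA.
  by apply: ler_wpM2l.
rewrite numE.
have valE : algRval ((1 - r%:R^-1) * (npairs G)%:R) = (1 - r%:R^-1) * (npairs G)%:R.
  by rewrite rmorphM rmorphB rmorph1 fmorphV !rmorph_nat.
have l2E : l ^+ 2 = algRval (lam ^+ 2) by rewrite rmorphXn -lamE.
rewrite -valE l2E.
(* At or above the bound, stability yields equality and the structure together. Below it, both sides
   of the equivalence fail: the extremal graphs have spectral radius at least the bound. *)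
have [lam_large|lam_small] := lerP ((1 - r%:R^-1) * (npairs G)%:R) (lam ^+ 2).
  have [-> Gmulti] := spectral_stability t'_gt1 r_gt1 simpleG HP Gfree' x_ge0
    x_norm lam_ge0 lam_le P_large editR lam_large.
  by split.
have l_small : algRval (lam ^+ 2) < algRval ((1 - r%:R^-1) * (npairs G)%:R) :=
  lam_small.
split; first exact: ltW.
split=> [e|Gmulti]; first by rewrite e ltxx in l_small.
suff : algRval ((1 - r%:R^-1) * (npairs G)%:R) <= algRval (lam ^+ 2).
  by move/(lt_le_trans l_small); rewrite ltxx.
rewrite valE -l2E; move: Gmulti; case: eqP => [->|_] Gmulti.
  exact: bipartite_spectral_radius_ge lG.
exact: (regular_spectral_radius_ge (ltnW r_gt1) Gmulti lG).
Qed.
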